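(* Let $p$ be an odd prime. Then $$\sum_{k=0}^{p-1}\frac{(q;q^2)_k^2}{(q^2;q^2)_k^2} \equiv \left(\frac{-1}{p}\right)q^{\frac{1-p^2}{4}}\pmod{[p]^2}.$$
   Context: $q$ is an indeterminate. $(a;q)_0=1$ and $(a;q)_n=(1-a)(1-aq)\cdots(1-aq^{n-1})$ for $n\ge 1$; so $(a;q^m)_n=\prod_{j=0}^{n-1}(1-aq^{mj})$. $\left(\frac{\cdot}{p}\right)$ is the Legendre symbol modulo $p$. $[p]=1+q+\cdots+q^{p-1}$, which is irreducible in $\mathbb{Q}[q]$ for $p$ prime. For rational functions $A(q),B(q)\in\mathbb{Q}(q)$ whose denominators are relatively prime to $[p]$, $A\equiv B\pmod{[p]^r}$ means that $A-B$ can be written as a fraction whose numerator is divisible by $[p]^r$ in $\mathbb{Q}[q]$ and whose denominator is relatively prime to $[p]$ (negative powers of $q$ are allowed). *)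

(* Defs.v *)
From HB Require Import structures.
From mathcomp Require Import all_boot all_order all_algebra.

Set Implicit Arguments.
Unset Strict Implicit.
Unset Printing Implicit Defensive.

Import Order.TTheory GRing.Theory Num.Theory.
Local Open Scope ring_scope.

Notation Qq := {fraction {poly rat}}.

Notation toQq := (@FracField.tofrac {poly rat}).

Definition q : Qq := toQq 'X.

(* (a; x)_n with base x, so (a; q^m)_n is [qpoch a (q ^+ m) n]. *)
Definition qpoch (R : comPzRingType) (a x : R) (n : nat) : R :=
  \prod_(j < n) (1 - a * x ^+ j).

Definition qint (n : nat) : {poly rat} := \sum_(i < n) 'X^i.

Definition legendre (a : int) (p : nat) : int :=
  if (p %| a)%Z then 0
  else if [exists x : 'I_p, ((x : nat)%:Z ^+ 2 == a %[mod p])%Z] then 1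
  else -1.

Definition denom_coprime (M : {poly rat}) (A : Qq) : Prop :=
  exists N D : {poly rat},
    [/\ D != 0, coprimep D M & A = toQq N / toQq D].

(* A = B mod M^r in Q(q).  The congruence is only defined for A and B with
   denominators prime to M, so these side conditions are part of it. *)
Definition qcong (M : {poly rat}) (r : nat) (A B : Qq) : Prop :=
  [/\ denom_coprime M A, denom_coprime M B &
      exists N D : {poly rat},
        [/\ D != 0, coprimep D M, M ^+ r %| N & A - B = toQq N / toQq D]].

(* Main.v *)
Require Import Defs.
From HB Require Import structures.
From mathcomp Require Import all_boot all_order all_algebra.
From mathcomp Require Import finfield ring zify.

Set Implicit Arguments.
Unset Strict Implicit.
Unset Printing Implicit Defensive.

Import Order.TTheory GRing.Theory Num.Theory.
Local Open Scope ring_scope.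

(** Put Q = q^2 and n = (p - 1)/2.  Since
      (1 - q^(a-p)) (1 - q^(a+p)) = (1 - q^a)^2 - q^(a-p) (1 - q^p)^2
    and [p] divides 1 - q^p, each squared factor of (q; q^2)_k^2 may be
    replaced modulo [p]^2 by the product of the factors with the same index of
    (q^(1-p); q^2)_k and (q^(1+p); q^2)_k ([qcong_factor]).  The denominators
    (q^2; q^2)_k with k < p are harmless: 1 - q^(2j) is prime to [p] when
    0 < j < p, because its common factors with 1 - q^p divide 1 - q, while [p]
    takes the nonzero value p at q = 1 ([qint_coprime_subXn]).

    The sum is therefore congruent to
      sum_k (Q^(-n); Q)_k (Q^(n+1); Q)_k / (Q; Q)_k^2,
    which terminates at k = n.  It is the q-Chu-Vandermonde sum with lower
    parameter Q, whose usual argument Q^(n+1)/Q^(n+1) happens to be 1, so it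
    equals (Q^(-n); Q)_n / (Q; Q)_n = (-1)^n Q^(-n(n+1)/2) exactly
    ([q_vandermonde_minus1]).  The exponent of q is -n(n+1) = (1 - p^2)/4, and
    (-1)^n is the Legendre symbol of -1 ([legendre_minus1]).

    The q-Chu-Vandermonde sum is evaluated by induction on n in the form
      S(x, y) = sum_k Q^k prod_(j < k) (x - Q^j)(y - Q^j) / (Q; Q)_k^2
      and  (Q; Q)_n S(x, Q^n) = (Qx; Q)_n,
    where x is the inverse of the free upper parameter.  The induction step is
    the first-order recurrence (1 - Qy) S(x, Qy) = (1 - Qxy) S(x, y) at
    y = Q^n, which holds because the difference of the two sides telescopes
    ([vterm_telescope]). *)

(** * The q-Chu-Vandermonde sum *)

Lemma qpochSr (R : comPzRingType) (a x : R) n :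
  qpoch a x n.+1 = qpoch a x n * (1 - a * x ^+ n).
Proof. by rewrite /qpoch big_ord_recr. Qed.

(** The Newton basis of polynomials in y for the nodes 1, Q, Q^2, ... *)
Definition qnewton (R : comPzRingType) (Q y : R) (k : nat) : R :=
  \prod_(j < k) (y - Q ^+ j).

Lemma qnewtonSr (R : comPzRingType) (Q y : R) k :
  qnewton Q y k.+1 = qnewton Q y k * (y - Q ^+ k).
Proof. by rewrite /qnewton big_ord_recr. Qed.

(** The nodes of [qnewton] form a geometric progression, so up to a power of Q
    dilating y by Q only trades the last node for the node 1/Q. *)
Lemma qnewton_shift (R : comPzRingType) (Q y : R) k :
  qnewton Q (Q * y) k.+1 = (Q * y - 1) * Q ^+ k * qnewton Q y k.
Proof.
elim: k => [|k IHk]; first by rewrite qnewtonSr /qnewton !big_ord0 expr0; ring.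
by rewrite qnewtonSr IHk qnewtonSr !exprS; ring.
Qed.

Lemma qnewton_eq0 (R : comPzRingType) (Q : R) n k :
  (n < k)%N -> qnewton Q (Q ^+ n) k = 0.
Proof.
by move=> ltnk; rewrite /qnewton (bigD1 (Ordinal ltnk)) //= subrr mul0r.
Qed.

(** Term of the terminating 2phi1 series with lower parameter Q.  With y = Q^n
    and x = 1/b it is the usual
    (Q^(-n); Q)_k (b; Q)_k / (Q; Q)_k^2 (Q^(n+1)/b)^k; in terms of x and y it is
    symmetric and polynomial, so that y can be treated as a variable. *)
Definition vterm (F : fieldType) (Q x y : F) (k : nat) : F :=
  Q ^+ k * qnewton Q x k * qnewton Q y k / qpoch Q Q k ^+ 2.

(** The powers of Q are spread over the factors so that the congruence with
    (q; q^2)_k^2 can be checked factor by factor. *)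
Lemma vterm_prod (F : fieldType) (Q x y : F) k :
  vterm Q x y k
  = \prod_(j < k) (Q * ((x - Q ^+ j) * (y - Q ^+ j))) / qpoch Q Q k ^+ 2.
Proof. by rewrite !big_split /= prodr_const card_ord mulrA. Qed.

(** The summand is a difference u(k+1) - u(k), where u(N+1) is the right-hand
    side.  The form of u is forced: by [qnewton_shift] both terms with index N+1
    are multiples of [qnewton Q y N * qnewton Q x N.+1], and comparing the
    coefficients of x leaves only the factor Q^(N+1) y beside the denominator. *)
Lemma vterm_telescope (F : fieldType) (Q x y : F) N :
    qpoch Q Q N != 0 ->
  \sum_(0 <= k < N.+1) ((1 - Q * y) * vterm Q x (Q * y) k
                        - (1 - Q * y * x) * vterm Q x y k)
  = Q ^+ N.+1 * y * qnewton Q y N * qnewton Q x N.+1 / qpoch Q Q N ^+ 2.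
Proof.
elim: N => [|N IHN] nz.
  rewrite big_nat1 /vterm qnewtonSr /qnewton /qpoch !big_ord0 expr0 expr1.
  by field; rewrite oner_neq0.
rewrite big_nat_recr //=; move: nz.
rewrite qpochSr mulf_eq0 negb_or => /andP[nzN nz1].
rewrite IHN // /vterm qnewton_shift !qpochSr !(qnewtonSr _ _ N.+1).
rewrite !(qnewtonSr _ _ N) !exprS.
by field; rewrite nz1 nzN.
Qed.

(** At y = Q^n the closed form of [vterm_telescope] vanishes once N > n, which
    turns it into a recurrence in n.  The bound N stays fixed during the
    induction; terms with k > n are zero, and the sum of interest runs up to
    p - 1. *)
Lemma q_vandermonde (F : fieldType) (Q x : F) n N :
    qpoch Q Q N != 0 -> (n <= N)%N ->
  qpoch Q Q n * \sum_(0 <= k < N.+1) vterm Q x (Q ^+ n) k = qpoch (Q * x) Q n.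
Proof.
move=> nzN; elim: n => [|n IHn] lenN.
  rewrite big_nat_recl // big1_seq => [|k _].
    by rewrite /vterm /qnewton /qpoch !big_ord0; field; rewrite oner_neq0.
  by rewrite /vterm (@qnewton_eq0 _ Q 0) // mulr0 mul0r.
have := vterm_telescope x (Q ^+ n) nzN.
rewrite qnewton_eq0 // mulr0 !mul0r sumrB -!mulr_sumr => /eqP.
rewrite subr_eq0 -exprS => /eqP step.
by rewrite !qpochSr -mulrA -exprS step mulrCA IHn 1?ltnW // exprS; ring.
Qed.

(** Reversing the order of the factors pairs 1 - Q^(-(i+1)) with 1 - Q^(i+1);
    their quotient is -Q^(-(i+1)), and the exponents add up to a triangular
    number. *)
Lemma qpoch_reflect (F : fieldType) (Q : F) n : Q != 0 ->
  qpoch (Q * Q ^- n.+1) Q n = (-1) ^+ n * Q ^- 'C(n.+1, 2) * qpoch Q Q n.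
Proof.
move=> nzQ; rewrite /qpoch (reindex_inj rev_ord_inj) /=.
rewrite -triangular_sum big_mkord big_ord_recl add0n.
rewrite -prodrXr -prodfV -[n in (-1) ^+ n]card_ord -prodr_const -!big_split /=.
apply: eq_bigr => i _.
have -> : n.+1 = ((n - i.+1) + i.+2)%N by have := ltn_ord i; lia.
rewrite /bump /= add1n exprD !exprS.
by field; rewrite nzQ !expf_neq0.
Qed.

Lemma q_vandermonde_minus1 (F : fieldType) (Q : F) n N :
    Q != 0 -> qpoch Q Q N != 0 -> (n <= N)%N ->
  \sum_(0 <= k < N.+1) vterm Q (Q ^- n.+1) (Q ^+ n) k
  = (-1) ^+ n * Q ^- 'C(n.+1, 2).
Proof.
move=> nzQ nzN lenN.
have nzn : qpoch Q Q n != 0.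
  apply: contraNneq nzN; rewrite /qpoch => /eqP/prodf_eq0[i _ /eqP i0].
  by rewrite (bigD1 (widen_ord lenN i)) //= i0 mul0r.
by apply: (mulfI nzn); rewrite q_vandermonde // qpoch_reflect // mulrC.
Qed.

(** * The Legendre symbol of -1 *)

(** A square root x of -1 satisfies x^(p-1) = (-1)^((p-1)/2), which is 1 by
    Fermat.  Conversely ((p-1)/2)! is a square root of -1 when (p-1)/2 is even,
    by Wilson's theorem and the pairing of i with p - i. *)
Lemma minus1_residue p : prime p -> odd p ->
  [exists x : 'I_p, ((x : nat)%:Z ^+ 2 == (-1) %[mod p])%Z] = ~~ odd p./2.
Proof.
move=> p_pr p_odd.
have dvdE (x : nat) :
    (x%:Z ^+ 2 == (-1) %[mod p])%Z = ((x%:R : 'F_p) ^+ 2 == -1).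
  rewrite eqz_mod_dvd -[_ == -1]addr_eq0 opprK expr2 -PoszM -PoszD.
  rewrite dvdzE !absz_nat.
  by rewrite (dvdn_pcharf (pchar_Fp p_pr)) natrD natrM expr2.
have card_Fp_odd : #|'F_p| = (p./2.*2).+1.
  by rewrite card_Fp // -[LHS]odd_double_half p_odd.
apply/existsP/idP => [[[x _]]|even_n] /=.
  rewrite dvdE => /eqP x2; apply/negP => odd_n.
  have := expf_card (x%:R : 'F_p); rewrite card_Fp_odd exprS.
  rewrite -mul2n exprM x2 -signr_odd odd_n expr1 mulrN1 => /eqP.
  rewrite eq_sym -addr_eq0 -mulr2n -[_ *+ 2]mulr_natr mulf_eq0.
  have /negPf-> : (2%:R : 'F_p) != 0.
    rewrite -(dvdn_pcharf (pchar_Fp p_pr)) gtnNdvd //.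
    by have := prime_gt1 p_pr; case: (p) p_odd => [|[|[]]].
  rewrite orbF => /eqP x0; move/eqP: x2.
  by rewrite x0 expr0n eq_sym oppr_eq0 oner_eq0.
have p_gt0 := prime_gt0 p_pr.
exists (Ordinal (ltn_pmod (p./2)`! p_gt0)); rewrite dvdE /=.
have -> : (((p./2)`! %% p)%:R : 'F_p) = (p./2)`!%:R.
  rewrite [in RHS](divn_eq (p./2)`! p) natrD natrM.
  by rewrite (pcharf0 (pchar_Fp p_pr)) mulr0 add0r.
have : ((p.-1)`!%:R : 'F_p) = -1.
  apply/eqP; rewrite -addr_eq0 natr1 -(dvdn_pcharf (pchar_Fp p_pr)).
  by rewrite -Wilson // prime_gt1.
(* (2n)! is the falling factorial (2n)(2n-1)...(n+1) times n!, and its factor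
   2n - i is -(i+1) modulo p. *)
move=> <-; have le_n2n : (p./2 <= p.-1)%N by lia.
rewrite -(ffact_fact le_n2n) natrM.
have -> : (p.-1 - p./2 = p./2)%N by lia.
rewrite expr2; apply/eqP; congr (_ * _).
rewrite ffact_prod fact_prod big_add1 big_mkord !natr_prod /=.
have -> : \prod_(i < p./2) ((p.-1 - i)%N%:R : 'F_p)
          = \prod_(i < p./2) - i.+1%:R.
  apply: eq_bigr => i _; apply/eqP; rewrite -addr_eq0 -natrD.
  have -> : (p.-1 - i + i.+1 = p)%N by have := ltn_ord i; lia.
  by rewrite (pcharf0 (pchar_Fp p_pr)).
by rewrite prodrN card_ord -signr_odd (negPf even_n) mul1r.
Qed.

Lemma legendre_minus1 p : prime p -> odd p ->
  legendre (-1) p = (-1) ^+ p./2.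
Proof.
move=> p_pr p_odd; rewrite /legendre minus1_residue // -signr_odd.
by rewrite dvdzE abszN1 dvdn1 gtn_eqF ?prime_gt1 //; case: odd.
Qed.

(** * Congruences between rational functions *)

Lemma denom_coprime_poly (M N : {poly rat}) : denom_coprime M (toQq N).
Proof.
exists N, 1; split; rewrite ?oner_neq0 ?coprime1p //.
by rewrite rmorph1 divr1.
Qed.

Lemma denom_coprimeD (M : {poly rat}) (A B : Qq) :
  denom_coprime M A -> denom_coprime M B -> denom_coprime M (A + B).
Proof.
move=> [N1 [D1 [nz1 co1 ->]]] [N2 [D2 [nz2 co2 ->]]].
exists (N1 * D2 + N2 * D1), (D1 * D2).
split; rewrite ?mulf_neq0 ?coprimepMl ?co1 //.
by rewrite !(rmorphD, rmorphM) addf_div ?tofrac_eq0.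
Qed.

Lemma denom_coprimeM (M : {poly rat}) (A B : Qq) :
  denom_coprime M A -> denom_coprime M B -> denom_coprime M (A * B).
Proof.
move=> [N1 [D1 [nz1 co1 ->]]] [N2 [D2 [nz2 co2 ->]]].
exists (N1 * N2), (D1 * D2).
by split; rewrite ?mulf_neq0 ?coprimepMl ?co1 // !rmorphM mulf_div.
Qed.

Lemma denom_coprimeX (M : {poly rat}) (A : Qq) n :
  denom_coprime M A -> denom_coprime M (A ^+ n).
Proof.
move=> OA; elim: n => [|n IHn]; last by rewrite exprS; apply: denom_coprimeM.
by rewrite expr0 -(rmorph1 toQq); apply: denom_coprime_poly.
Qed.

Lemma denom_coprimeV (M D : {poly rat}) :
  D != 0 -> coprimep D M -> denom_coprime M (toQq D)^-1.
Proof. by exists 1, D; rewrite rmorph1 mul1r. Qed.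

(** Congruence means that the difference lies in M^r times the ring of fractions
    with denominator prime to M; with [qcongE], this form makes the
    compatibility with ring operations a matter of ring identities. *)
Lemma qcongI (M : {poly rat}) r (A B E : Qq) :
    denom_coprime M A -> denom_coprime M B -> denom_coprime M E ->
  A - B = toQq M ^+ r * E -> qcong M r A B.
Proof.
move=> OA OB [N [D [nzD coD defE]]] eqAB; split=> //.
exists (M ^+ r * N), D; split; rewrite ?dvdp_mulr //.
by rewrite eqAB defE rmorphM rmorphXn mulrA.
Qed.

Lemma qcongE (M : {poly rat}) r (A B : Qq) : qcong M r A B ->
  exists2 E, denom_coprime M E & A - B = toQq M ^+ r * E.
Proof.
case=> _ _ [_ [D [nzD coD /dvdpP[N ->] eqAB]]].
exists (toQq N / toQq D); first by exists N, D.
by rewrite eqAB rmorphM rmorphXn mulrAC mulrC.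
Qed.

Lemma qcong_refl (M : {poly rat}) r (A : Qq) :
  denom_coprime M A -> qcong M r A A.
Proof.
move=> OA; apply: (@qcongI _ _ _ _ (toQq 0)) => //.
  exact: denom_coprime_poly.
by rewrite subrr rmorph0 mulr0.
Qed.

Lemma qcongD (M : {poly rat}) r (A B A' B' : Qq) :
  qcong M r A B -> qcong M r A' B' -> qcong M r (A + A') (B + B').
Proof.
move=> cAB cAB'.
have [E OE eqE] := qcongE cAB; have [E' OE' eqE'] := qcongE cAB'.
case: cAB cAB' => OA OB _ [OA' OB' _].
apply: (@qcongI _ _ _ _ (E + E')); do ?exact: denom_coprimeD.
by rewrite opprD addrACA eqE eqE' mulrDr.
Qed.

Lemma qcongM (M : {poly rat}) r (A B A' B' : Qq) :
  qcong M r A B -> qcong M r A' B' -> qcong M r (A * A') (B * B').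
Proof.
move=> cAB cAB'.
have [E OE eqE] := qcongE cAB; have [E' OE' eqE'] := qcongE cAB'.
case: cAB cAB' => OA OB _ [OA' OB' _].
apply: (@qcongI _ _ _ _ (A * E' + E * B')); do ?exact: denom_coprimeM.
  by apply: denom_coprimeD; apply: denom_coprimeM.
have -> : A * A' - B * B' = A * (A' - B') + (A - B) * B' by ring.
by rewrite eqE eqE'; ring.
Qed.

(** * Elements prime to [p] *)

Lemma qint_geom n : 1 - 'X^n = (1 - 'X) * qint n.
Proof. by rewrite -opprB subrX1 -mulNr opprB. Qed.

Lemma qint_coprime_X n : (0 < n)%N -> coprimep 'X (qint n).
Proof.
case: n => // n _; rewrite coprimep_sym -['X]subr0 -polyC0 coprimep_XsubC.
rewrite /root /qint horner_sum big_ord_recl big1 => [|i _].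
  by rewrite addr0 expr0 hornerE oner_eq0.
by rewrite hornerXn expr0n.
Qed.

(** By Bezout, a common divisor of 1 - X^m and 1 - X^n divides 1 - X; but 1 is
    not a root of [n], whose value there is n. *)
Lemma qint_coprime_subXn n m : (0 < n)%N -> (0 < m)%N -> coprime m n ->
  coprimep (1 - 'X^m) (qint n).
Proof.
move=> n_gt0 m_gt0 co_mn; apply/coprimepP => d d_m d_n.
have d_geom k l : d %| 1 - 'X^k -> d %| 1 - 'X^(l * k).
  move=> /dvdp_trans; apply; rewrite mulnC exprM.
  by rewrite -[1 - _ ^+ l]opprB subrX1 -mulNr opprB dvdp_mulr.
have d_n' : d %| 1 - 'X^n by rewrite qint_geom dvdp_mull.
have d_1 : d %| 'X - 1%:P.
  case: (egcdnP n m_gt0) => a b; rewrite (eqP co_mn) => def_a _.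
  have -> : 'X - 1%:P = 'X * (1 - 'X^(b * n)) - (1 - 'X^(a * m)) :> {poly rat}.
    by rewrite def_a addn1 exprS; ring.
  by rewrite dvdp_sub ?dvdp_mull ?d_geom.
have /coprimepP : coprimep (qint n) ('X - 1%:P).
  rewrite coprimep_XsubC /root /qint horner_sum.
  under eq_bigr do rewrite hornerXn expr1n.
  by rewrite sumr_const card_ord pnatr_eq0 -lt0n.
exact.
Qed.

Lemma subXn_neq0 m : (0 < m)%N -> 1 - 'X^m != 0 :> {poly rat}.
Proof.
by move=> m_gt0; rewrite -oppr_eq0 opprB -size_poly_eq0 size_XnsubC.
Qed.

(** For k < p, all exponents 2(j+1) with j < k are prime to p, so (q^2; q^2)_k
    is a unit of the ring of fractions in which the congruence takes place. *)
Lemma qpoch_even_unit p k : prime p -> odd p -> (k < p)%N ->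
  qpoch (q ^+ 2) (q ^+ 2) k != 0 /\
  denom_coprime (qint p) (qpoch (q ^+ 2) (q ^+ 2) k)^-1.
Proof.
move=> p_pr p_odd; elim: k => [_|k IHk ltkp].
  rewrite /qpoch big_ord0 oner_neq0 invr1; split=> //.
  exact: (denom_coprime_poly _ 1).
have [nz ok] := IHk (ltnW ltkp); rewrite qpochSr.
have -> : 1 - q ^+ 2 * (q ^+ 2) ^+ k = toQq (1 - 'X^(2 * k.+1)).
  by rewrite -exprS -exprM rmorphB rmorph1 rmorphXn.
have nzk : 1 - 'X^(2 * k.+1) != 0 :> {poly rat} by apply: subXn_neq0.
split; first by rewrite mulf_neq0 ?tofrac_eq0.
rewrite invfM; apply: denom_coprimeM => //; apply: denom_coprimeV => //.
apply: qint_coprime_subXn; rewrite ?(prime_gt0 p_pr) // coprimeMl.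
by rewrite coprime2n p_odd /= coprime_sym prime_coprime // gtnNdvd.
Qed.

(** * Reduction to the terminating series *)

(** With a = 2j + 1 and p = 2n + 1 this is
      (1 - s^a)^2 - (1 - s^(a-p)) (1 - s^(a+p)) = s^(a-p) (1 - s^p)^2. *)
Lemma paired_factor_defect (F : fieldType) (s : F) n j : s != 0 ->
  (1 - s * (s ^+ 2) ^+ j) ^+ 2
  - s ^+ 2 * (((s ^+ 2) ^- n.+1 - (s ^+ 2) ^+ j)
              * ((s ^+ 2) ^+ n - (s ^+ 2) ^+ j))
  = s ^+ j.*2.+1 * s ^- n.*2.+1 * (1 - s ^+ n.*2.+1) ^+ 2.
Proof.
move=> nzs; rewrite ![(s ^+ 2) ^+ _.+1]exprS ![s ^+ _.*2.+1]exprS.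
rewrite -!mul2n ![s ^+ (2 * _)]exprM.
by field; rewrite nzs !expf_neq0.
Qed.

Lemma qcong_factor p j : odd p ->
  qcong (qint p) 2 ((1 - q * (q ^+ 2) ^+ j) ^+ 2)
    (q ^+ 2 * (((q ^+ 2) ^- p./2.+1 - (q ^+ 2) ^+ j)
               * ((q ^+ 2) ^+ p./2 - (q ^+ 2) ^+ j))).
Proof.
move=> p_odd; have p_gt0 := odd_gt0 p_odd.
have nzq : q != 0 by rewrite tofrac_eq0 polyX_eq0.
have Oq n : denom_coprime (qint p) (q ^+ n).
  by apply: denom_coprimeX; apply: denom_coprime_poly.
have OqV n : denom_coprime (qint p) (q ^- n).
  rewrite -exprVn; apply/denom_coprimeX/denom_coprimeV.
    by rewrite polyX_eq0.
  exact: qint_coprime_X.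
have OqB n : denom_coprime (qint p) (1 - q ^+ n).
  by rewrite /q -rmorphXn -(rmorph1 toQq) -rmorphB; apply: denom_coprime_poly.
set A := _ ^+ 2; set B := q ^+ 2 * _.
pose E := q ^+ j.*2.+1 * q ^- p * (1 - q ^+ 1) ^+ 2.
have OA : denom_coprime (qint p) A.
  by rewrite /A -exprM -exprS; apply: denom_coprimeX.
have OE : denom_coprime (qint p) E.
  by do 2?apply: denom_coprimeM; rewrite ?denom_coprimeX.
have eqAB : A - B = toQq (qint p) ^+ 2 * E.
  rewrite /E mulrCA -exprMn [toQq _ * _]mulrC expr1.
  have -> : (1 - q) * toQq (qint p) = 1 - q ^+ p.
    by rewrite /q -rmorphXn -(rmorph1 toQq) -!rmorphB qint_geom rmorphM.
  have defp : p = p./2.*2.+1 by rewrite -[LHS]odd_double_half p_odd.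
  by rewrite /A /B paired_factor_defect // -defp.
(* The denominator of B is read off from those of A and E. *)
have -> : B = A + toQq (- qint p ^+ 2) * E.
  by rewrite rmorphN rmorphXn mulNr -eqAB; ring.
apply: (@qcongI _ _ _ _ E) => //.
  by apply/denom_coprimeD/denom_coprimeM => //; apply: denom_coprime_poly.
by rewrite rmorphN rmorphXn; ring.
Qed.

Lemma qcong_term p k : prime p -> odd p -> (k < p)%N ->
  qcong (qint p) 2 (qpoch q (q ^+ 2) k ^+ 2 / qpoch (q ^+ 2) (q ^+ 2) k ^+ 2)
    (vterm (q ^+ 2) ((q ^+ 2) ^- p./2.+1) ((q ^+ 2) ^+ p./2) k).
Proof.
move=> p_pr p_odd ltkp; rewrite vterm_prod; apply: qcongM; last first.
  apply: qcong_refl; rewrite -exprVn; apply: denom_coprimeX.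
  by case: (qpoch_even_unit p_pr p_odd ltkp).
rewrite /qpoch -prodrXl; apply: (big_ind2 (qcong (qint p) 2)).
- exact/qcong_refl/(@denom_coprime_poly _ 1).
- by move=> A B A' B'; apply: qcongM.
by move=> j _; apply: qcong_factor.
Qed.

Theorem corollary2p2 (p : nat) (p_prime : prime p) (p_odd : odd p) :
  qcong (qint p) 2
    (\sum_(0 <= k < p) qpoch q (q ^+ 2) k ^+ 2 / qpoch (q ^+ 2) (q ^+ 2) k ^+ 2)
    ((legendre (-1) p)%:~R * q ^ ((1 - p%:Z ^+ 2) %/ 4)%Z).
Proof.
have p_gt0 := prime_gt0 p_prime; set n := p./2.
have defp : p = n.*2.+1 by rewrite -[LHS]odd_double_half p_odd.
have -> : ((1 - p%:Z ^+ 2) %/ 4)%Z = - (2 * 'C(n.+1, 2))%:Z.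
  rewrite -mul_bin_diag bin1.
  have -> : 1 - p%:Z ^+ 2 = - (n.+1 * n)%N%:Z * 4 by rewrite defp; lia.
  by rewrite mulzK.
have -> : (legendre (-1) p)%:~R * q ^ (- (2 * 'C(n.+1, 2))%:Z)
    = \sum_(0 <= k < p) vterm (q ^+ 2) ((q ^+ 2) ^- n.+1) ((q ^+ 2) ^+ n) k.
  have ltp1p : (p.-1 < p)%N by rewrite prednK.
  rewrite -[p in RHS]prednK // q_vandermonde_minus1; last by lia.
  - by rewrite legendre_minus1 // rmorphXn rmorphN1 -exprM -exprnN.
  - by rewrite expf_neq0 // tofrac_eq0 polyX_eq0.
  by case: (qpoch_even_unit p_prime p_odd ltp1p).
rewrite big_nat [X in qcong _ _ _ X]big_nat.
apply: (big_ind2 (qcong (qint p) 2)).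
- exact/qcong_refl/(@denom_coprime_poly _ 0).
- by move=> A B A' B'; apply: qcongD.
by move=> k /andP[_ ltkp]; apply: qcong_term.
Qed.
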